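(* Let $T'\in\mathcal L(\mathcal H')$ be a completely nonunitary contraction, $T\in\mathcal L(\mathcal H)$ an isometry, and $X\in\mathcal L(\mathcal H,\mathcal H')$ with $T'X=XT$. Let $U'\in\mathcal L(\mathcal K')$ be the minimal isometric lifting of $T'$. Assume $\|X\|<1$ and that there is an isometric intertwining lifting $Y_1$ of $X$, i.e. an isometry $Y_1\in\mathcal L(\mathcal H,\mathcal K')$ with $U'Y_1=Y_1T$ and $P'Y_1=X$. Then $T$ is a unilateral shift.
   Context: Hilbert spaces are complex and separable. The minimal isometric lifting $U'$ of $T'$ is an isometry on a Hilbert space $\mathcal K'\supset\mathcal H'$ with $P'U'=T'P'$, where $P'$ is the orthogonal projection of $\mathcal K'$ onto $\mathcal H'$, and $\mathcal K'=\bigvee_{n\ge0}U'^n\mathcal H'$. A unilateral shift (of arbitrary multiplicity) is an isometry with no nonzero unitary part in its Wold decomposition. *)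

(* Defs.v *)
From HB Require Import structures.
From mathcomp Require Import all_boot all_order all_algebra sesquilinear.
From mathcomp Require Import complex.
From mathcomp Require Import all_classical all_reals all_analysis.

Set Implicit Arguments.
Unset Strict Implicit.
Unset Printing Implicit Defensive.

Import Order.TTheory GRing.Theory Num.Theory.
Import numFieldNormedType.Exports.

Local Open Scope classical_set_scope.
Local Open Scope ring_scope.

(* Complex Hilbert spaces. The inner product is linear in its first argument
   and conjugate-linear in the second; positive definiteness is part of
   {dot _ for _}. *)
HB.mixin Record hasInnerProduct (R : realType) (H : Type)
    of CompleteNormedModule R[i] H := {
  hdot : {dot H for (@Num.conj R[i])} ;
  hdot_norm : forall x : H, hdot x x = `|x| ^+ 2 }.

#[short(type="hilbertType")]
HB.structure Definition Hilbert (R : realType) :=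
  {H of CompleteNormedModule R[i] H & hasInnerProduct R H}.

Definition separable (T : topologicalType) : Prop :=
  exists A : set T, countable A /\ dense A.

Section Operators.
Context {R : realType}.
Implicit Types H K : hilbertType R.

(* Norms take their values in R[i], whence the real part. This is the operator
   norm only when f is continuous: the supremum of an unbounded set is 0. *)
Definition opnorm {H K} (f : {linear H -> K}) : R :=
  sup [set complex.Re `|f x| | x in [set x : H | `|x| <= 1]].

Definition contraction_operator {H K} (f : {linear H -> K}) : Prop :=
  continuous f /\ opnorm f <= 1.

Definition isometric {H K} (f : {linear H -> K}) : Prop :=
  forall x : H, `|f x| = `|x|.

Definition closed_subspace {H} (M : set H) : Prop :=
  [/\ closed M, M 0 & forall (a : R[i]) (x y : H), M x -> M y -> M (a *: x + y)].

(* the join of the members of a family of sets is the closed_span of its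
   union *)
Definition closed_span {H} (A : set H) : set H := smallest closed_subspace A.

Definition orthocompl {H} (A : set H) : set H :=
  [set x | forall y, A y -> hdot x y = 0].

Definition reducing {H} (T : {linear H -> H}) (M : set H) : Prop :=
  [/\ closed_subspace M, T @` M `<=` M & T @` orthocompl M `<=` orthocompl M].

(* the restriction of T to the subspace M is a unitary operator on M *)
Definition unitary_on {H} (T : {linear H -> H}) (M : set H) : Prop :=
  T @` M = M /\ forall x, M x -> `|T x| = `|x|.

Definition completely_nonunitary {H} (T : {linear H -> H}) : Prop :=
  forall M : set H, reducing T M -> unitary_on T M -> M = [set 0].

(* The Wold decomposition Hu (+) Hs of an isometry T: the unitary part Hu
   reduces T to a unitary operator, and its complement Hs is the join of the
   spaces T^n L, where L is the wandering space (range T)^perp. *)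
Definition wold_decomposition {H} (T : {linear H -> H}) (Hu Hs : set H) : Prop :=
  [/\ reducing T Hu, unitary_on T Hu, Hs = orthocompl Hu
    & Hs = closed_span (\bigcup_n (iter n T @` orthocompl (range T)))].

Definition unilateral_shift {H} (T : {linear H -> H}) : Prop :=
  isometric T /\
  exists Hu Hs : set H, wold_decomposition T Hu Hs /\ Hu = [set 0].

(* H is regarded as a subspace of K through the isometric embedding J, and
   P : K -> H is then the orthogonal projection: k - J (P k) is orthogonal to
   J H for every k. *)
Definition orthogonal_projection {H K}
    (J : {linear H -> K}) (P : {linear K -> H}) : Prop :=
  forall (k : K) (h : H), hdot (k - J (P k)) (J h) = 0.

Definition minimal_isometric_lifting {H K} (T : {linear H -> H})
    (J : {linear H -> K}) (P : {linear K -> H}) (U : {linear K -> K}) : Prop :=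
  [/\ isometric J,
      orthogonal_projection J P,
      isometric U,
      forall k : K, P (U k) = T (P k)
    & closed_span (\bigcup_n (iter n U @` range J)) = setT].

End Operators.

(* Main.v *)
(* The unitary part of T consists of the vectors h = T^n g_n divisible by every
   power of T. Let q_n = Y_1 g_n - X g_n be the component of Y_1 g_n orthogonal
   to H'. Since ||X|| < 1, |q_n|^2 >= (1 - ||X||^2) |h|^2. On the other hand
   |q_n|^2 = <q_n, Y_1 g_n> = <U'^n q_n, Y_1 h>, and U'^n tends weakly to 0
   uniformly on the unit ball of the complement of H', as one checks on the total
   set of vectors U'^m x, x in H'. Hence h = 0. *)
Require Import Defs.
From HB Require Import structures.
From mathcomp Require Import all_boot all_order all_algebra sesquilinear.
From mathcomp Require Import complex.
From mathcomp Require Import all_classical all_reals all_analysis.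
From mathcomp Require Import ring.

Import Order.TTheory GRing.Theory Num.Theory.
Import numFieldNormedType.Exports.

Local Open Scope classical_set_scope.
Local Open Scope ring_scope.

Section HilbertSpaces.
Set Implicit Arguments.
Unset Strict Implicit.
Context {R : realType}.
Implicit Types H K : hilbertType R.

(** * Inner product identities *)

Lemma hdotC H (x y : H) : hdot x y = (hdot y x)^*.
Proof. by rewrite hermC expr0 mul1r. Qed.

Lemma hdotZr H (a : R[i]) (x y : H) : hdot x (a *: y) = a^* * hdot x y.
Proof. exact: linearZr_LR. Qed.

Lemma hdotZl H (a : R[i]) (x y : H) : hdot (a *: x) y = a * hdot x y.
Proof. exact: linearZl_LR. Qed.

Lemma hdotNr H (x y : H) : hdot x (- y) = - hdot x y.
Proof. exact: linearNr. Qed.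

Lemma normD_sqr H (x y : H) :
  `|x + y| ^+ 2 = `|x| ^+ 2 + `|y| ^+ 2 + (hdot x y + (hdot x y)^*).
Proof. by rewrite -!hdot_norm dnormD. Qed.

Lemma pythagoras H (x y : H) :
  hdot x y = 0 -> `|x + y| ^+ 2 = `|x| ^+ 2 + `|y| ^+ 2.
Proof. by move=> xy0; rewrite normD_sqr xy0 conjC0 !addr0. Qed.

Lemma parallelogram H (x y : H) :
  `|x + y| ^+ 2 + `|x - y| ^+ 2 = 2 * `|x| ^+ 2 + 2 * `|y| ^+ 2.
Proof.
by rewrite !normD_sqr normrN hdotNr rmorphN /=; ring.
Qed.

(** Subtracting the projection onto the line of [z] lowers the squared norm by an explicit amount.
    Nonnegativity of the result is Cauchy-Schwarz; at [z = 0] the convention [0^-1 = 0] makes the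
    correction vanish. *)
Lemma norm_sub_proj H (x z : H) :
  `|x - (hdot x z / `|z| ^+ 2) *: z| ^+ 2 =
  `|x| ^+ 2 - `|hdot x z| ^+ 2 / `|z| ^+ 2.
Proof.
have [->|z0] := eqVneq z 0.
  by rewrite scaler0 subr0 normr0 expr0n invr0 mulr0 subr0.
have r0 : `|z| ^+ 2 != 0 by rewrite expf_neq0 ?normr_eq0.
have rR : (`|z| ^+ 2)^* = `|z| ^+ 2 by apply/CrealP; rewrite rpredX ?normr_real.
rewrite normD_sqr normrN hdotNr hdotZr normrZ exprMn normf_div expr_div_n.
rewrite normrX normr_id.
have -> : (hdot x z / `|z| ^+ 2)^* = (hdot x z)^* / `|z| ^+ 2.
  by rewrite rmorphM fmorphV /= rR.
rewrite rmorphN rmorphM rmorphM fmorphV /= rR conjCK !normCK.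
by field; rewrite normr_eq0.
Qed.

Lemma cauchy_schwarz H (x y : H) : `|hdot x y| <= `|x| * `|y|.
Proof.
have [->|y0] := eqVneq y 0; first by rewrite linear0r !normr0 mulr0.
have y2 : 0 < `|y| ^+ 2 by rewrite exprn_gt0 ?normr_gt0.
rewrite -ler_sqr ?nnegrE ?mulr_ge0// exprMn -ler_pdivrMr// -subr_ge0.
by rewrite -norm_sub_proj exprn_ge0.
Qed.

(* Polarization: apply the norm identity to x + y and to i x + y. *)
Lemma isometric_hdot H K (f : {linear H -> K}) :
  isometric f -> forall x y, hdot (f x) (f y) = hdot x y.
Proof.
move=> isof x y.
have re (u v : H) : hdot (f u) (f v) + (hdot (f u) (f v))^* =
    hdot u v + (hdot u v)^*.
  by apply: (addrI (`|u| ^+ 2 + `|v| ^+ 2));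
    rewrite -normD_sqr -!isof linearD normD_sqr.
have := re ('i *: x) y; rewrite linearZ/= !hdotZl !rmorphM /= conjCi !mulNr.
rewrite -!mulrBr => /(mulfI (neq0Ci _)) im.
have double (a : R[i]) : a + a^* + (a - a^*) = 2 * a by ring.
by have := congr2 +%R (re x y) im; rewrite !double => /(mulfI _); apply.
Qed.

Lemma isometric_iter_hdot H (f : {linear H -> H}) n :
  isometric f -> forall x y, hdot (iter n f x) (iter n f y) = hdot x y.
Proof.
move=> isof x y; elim: n => //= n IH.
by rewrite isometric_hdot.
Qed.

Lemma isometric_iter H (f : {linear H -> H}) n :
  isometric f -> forall x, `|iter n f x| = `|x|.
Proof. by move=> isof x; elim: n => //= n <-; exact: isof. Qed.

(** * Completeness and projection onto closed subspaces *)

Lemma closed_approx H (A : set H) :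
  (forall x, (forall e, 0 < e -> exists2 y, A y & `|x - y| < e) -> A x) ->
  closed A.
Proof.
move=> clA x clx; apply: clA => e e0.
have [y [Ay]] := clx _ (nbhsx_ballx x e e0).
by rewrite -ball_normE; exists y.
Qed.

Lemma closed_approxP H (A : set H) : closed A ->
  forall x, (forall e, 0 < e -> exists2 y, A y & `|x - y| < e) -> A x.
Proof.
move=> clA x near_x; apply: clA => B /nbhs_ballP[e /= e0 eB].
have [y Ay xy] := near_x e e0; exists y; split=> //; apply: eB.
by rewrite -ball_normE.
Qed.

(* Cantor's intersection theorem in approximate form. *)
Lemma nested_limit H (B : R[i] -> set H) :
  (forall e, 0 < e -> B e !=set0) ->
  (forall e e', 0 < e -> e <= e' -> B e `<=` B e') ->
  (forall e, 0 < e ->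
     exists2 d, 0 < d & forall x y, B d x -> B d y -> `|x - y| < e) ->
  exists y, forall d e, 0 < d -> 0 < e -> exists2 x, B d x & `|y - x| < e.
Proof.
move=> B0 nested small.
pose F := filter_from [set e : R[i] | 0 < e] B.
have FF : ProperFilter F.
  apply: filter_from_proper; last exact: B0.
  apply: filter_from_filter; first by exists 1 => /=; exact: ltr01.
  move=> i j /= i0 j0.
  (* The order of [R[i]] is partial, but positive elements are real and hence comparable. *)
  have [ij|ji] := real_leP (gtr0_real i0) (gtr0_real j0).
    by exists i => // x Bx; split=> //; exact: nested Bx.
  by exists j => // x Bx; split=> //; exact: (nested _ _ j0 (ltW ji) _ Bx).
have /cauchy_ballP/cauchy_cvg/cvg_ex[y /= Fy] : cauchy_ball F.
  move=> e e0; have [d d0 dsmall] := small e e0.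
  exists (B d, B d) => /=; first by split; exists d.
  by move=> [u v] /= [Bu Bv]; rewrite -ball_normE; exact: dsmall.
exists y => d e d0 e0.
have Fball : F (ball y e) by apply: Fy; exact: nbhsx_ballx.
have FB : F (B d) by exists d.
have [x [Bx yx]] := filter_ex (filterI FB Fball).
by exists x => //; rewrite -ball_normE in yx.
Qed.

Lemma ball_approx_eq0 H (x : H) : (forall e, 0 < e -> `|x| < e) -> x = 0.
Proof.
move=> small; apply/eqP; rewrite -normr_eq0; apply: contraT => x0.
by have := small `|x|; rewrite ltxx lt_def x0 normr_ge0 => /(_ isT).
Qed.

(** Infima exist in [R] and not in [R[i]], so the infimum is taken over real parts and embedded
    back. *)
Lemma distance_exists H (M : set H) (x : H) : M !=set0 ->
  exists2 d : R[i], (forall m, M m -> d <= `|x - m| ^+ 2) &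
    forall e, 0 < e -> exists2 m, M m & `|x - m| ^+ 2 < d + e.
Proof.
move=> [m0 Mm0].
pose E := [set complex.Re (`|x - m| ^+ 2) | m in M].
have sqC (m : H) : (complex.Re (`|x - m| ^+ 2))%:C%C = `|x - m| ^+ 2.
  by apply: RRe_real; rewrite rpredX ?normr_real.
have lb : lbound E 0.
  by move=> _ [m _ <-]; rewrite -ler0c sqC exprn_ge0.
have infE : has_inf E by split; [exists (complex.Re (`|x - m0| ^+ 2)), m0|exists 0].
exists (inf E)%:C%C => [m Mm|e e0].
  by rewrite -sqC lecR; apply: ge_inf; [exists 0|exists m].
have eC : (complex.Re e)%:C%C = e by apply: RRe_real; exact: gtr0_real.
have Re0 : 0 < complex.Re e by rewrite -ltcR eC.
have [_ [m Mm <-] lt] := inf_adherent Re0 infE.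
by exists m => //; rewrite -sqC -eC -rmorphD ltcR.
Qed.

(* Almost minimizing vectors of M are close by the parallelogram identity. *)
Lemma orthogonal_decomposition H (M : set H) : closed_subspace M ->
  forall x, exists2 m, M m & forall z, M z -> hdot (x - m) z = 0.
Proof.
move=> [clM M0 linM] x.
have [d dlb dadh] := @distance_exists H M x (ex_intro _ 0 M0).
pose B e := [set m | M m /\ `|x - m| ^+ 2 < d + e].
have [||e e0|y yP] := @nested_limit H B.
- by move=> e e0; have [m Mm lt] := dadh e e0; exists m.
- by move=> e e' e0 ee' m [Mm lt]; split=> //; apply: lt_le_trans lt _; rewrite lerD2l.
(* The midpoint of [u] and [v] is in [M], so the parallelogram identity gives
   [|u - v|^2 < 4 (d + e^2 / 4) - 4 d = e^2]. *)
- exists (e ^+ 2 / 4) => [|u v [Mu ltu] [Mv ltv]].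
    by rewrite divr_gt0 ?exprn_gt0.
  rewrite -ltr_sqr ?nnegrE ?normr_ge0 ?(ltW e0)//.
  have Mmid : M (2^-1 *: (u + v)).
    have := linM 1 u v Mu Mv; rewrite scale1r => Muv.
    by have := linM 2^-1 _ _ Muv M0; rewrite addr0.
  have mid : `|(x - v) + (x - u)| ^+ 2 = 4 * `|x - 2^-1 *: (u + v)| ^+ 2.
    have -> : (x - v) + (x - u) = 2 *: (x - 2^-1 *: (u + v)).
      rewrite scalerBr scalerA divff ?pnatr_eq0// scale1r scaler_nat mulr2n.
      by rewrite opprD addrACA [- v - u]addrC.
    rewrite normrZ exprMn ger0_norm//; by ring.
  have := parallelogram (x - v) (x - u).
  have -> : x - v - (x - u) = u - v by rewrite opprB addrC addrA subrK.
  rewrite mid => /(canRL (addKr _)) ->.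
  have -> : e ^+ 2 = - (4 * d) + (2 * (d + e ^+ 2 / 4) + 2 * (d + e ^+ 2 / 4)).
    by field.
  apply: ler_ltD; first by rewrite lerN2 ler_pM2l// dlb.
  by apply: ltrD; rewrite ltr_pM2l.
exists y.
  apply: (closed_approxP clM) => e e0.
  by have [m [Mm _] ym] := yP 1 e ltr01 e0; exists m.
move=> z Mz; apply/eqP; rewrite -normr_eq0.
have [->|z0] := eqVneq z 0; first by rewrite linear0r normr0.
have nz : 0 < `|z| by rewrite normr_gt0.
apply: contraT => w0; have {}w0 : 0 < `|hdot (x - y) z| by rewrite lt_def w0 /=.
set w := `|hdot (x - y) z| in w0 *.
(* With [m] in [M] satisfying [|x - m|^2 < d + e^2] and [|y - m| < e], both [<x - m, z>] and
   [<m - y, z>] are smaller than [e |z| = w / 2]: the first because moving [m] along [z] cannot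
   bring the squared distance below [d], the second by Cauchy-Schwarz. Their sum has modulus [w]. *)
pose e := w / 2 / `|z|.
have e0 : 0 < e by rewrite !divr_gt0.
have [m [Mm lt] ym] := yP _ _ (exprn_gt0 2 e0) e0.
have h1 : `|hdot (x - m) z| < w / 2.
  have Mt : M (m + (hdot (x - m) z / `|z| ^+ 2) *: z).
    by rewrite addrC; exact: linM.
  have := dlb _ Mt; rewrite opprD addrA norm_sub_proj => /le_lt_trans.
  move/(_ (d + e ^+ 2 - `|hdot (x - m) z| ^+ 2 / `|z| ^+ 2)).
  rewrite ltrD2r => /(_ lt); rewrite -addrA ltrDl subr_gt0.
  rewrite -expr_div_n ltr_sqr ?nnegrE ?(ltW e0) ?divr_ge0// /e.
  by rewrite ltr_pM2r ?invr_gt0.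
have h2 : `|hdot (m - y) z| < w / 2.
  apply: le_lt_trans (cauchy_schwarz _ _) _.
  by rewrite -ltr_pdivlMr// distrC.
have : w < w.
  rewrite {1}/w -[x - y](subrKA m) linearDl /=.
  apply: le_lt_trans (ler_normD _ _) _.
  by rewrite (splitr w) ltrD.
by rewrite ltxx.
Qed.

(** * Closed spans, ranges of isometries and the operator norm *)

Lemma closed_span_closed_subspace H (A : set H) : closed_subspace (closed_span A).
Proof.
split.
- by apply: closed_bigI => M [[]].
- by move=> M [[_ M0 _] _].
- move=> a x y Ax Ay M MP; case: (MP) => -[_ _ linM] _.
  by apply: linM; [exact: Ax|exact: Ay].
Qed.

(** Preimages of good approximations of a point are as close together as the approximations, so
    completeness of [H] provides a preimage of the limit. *)
Lemma isometric_range_closed_subspace H K (f : {linear H -> K}) :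
  isometric f -> closed_subspace (range f).
Proof.
move=> isof; split.
- apply: closed_approx => x near_x.
  have [||e e0|y yP] := @nested_limit H (fun e => [set y | `|x - f y| < e]).
  + by move=> e /near_x[_ [y _ <-]]; exists y.
  + by move=> e e' _ ee' y /= /lt_le_trans; exact.
  + exists (e / 2) => [|u v /= xu xv]; first by rewrite divr_gt0.
    rewrite -isof linearB -(subrKA x) (splitr e).
    by apply: le_lt_trans (ler_normD _ _) _; rewrite ltrD// distrC.
  exists y => //; apply/esym/eqP; rewrite -subr_eq0; apply/eqP.
  apply: ball_approx_eq0 => e e0.
  have e20 : 0 < e / 2 by rewrite divr_gt0.
  have [u /= xu yu] := yP _ _ e20 e20.
  rewrite -(subrKA (f u)) (splitr e).
  apply: le_lt_trans (ler_normD _ _) _; rewrite ltrD//.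
  by rewrite distrC -linearB isof.
- by exists 0 => //; exact: linear0.
- by move=> a _ _ [x _ <-] [y _ <-]; exists (a *: x + y) => //; rewrite linearP.
Qed.

Lemma orthogonal_projectionK H K (J : {linear H -> K}) (P : {linear K -> H}) :
  isometric J -> orthogonal_projection J P -> cancel J P.
Proof.
move=> isoJ orthP x; apply/esym/eqP; rewrite -subr_eq0 -normr_eq0 -isoJ.
by rewrite -sqrf_eq0 -hdot_norm {1}linearB orthP.
Qed.

(** Continuity bounds the set under the supremum, so [opnorm f] is not a default value. *)
Lemma le_opnorm H K (f : {linear H -> K}) : continuous f ->
  forall x, `|f x| <= (opnorm f)%:C%C * `|x|.
Proof.
move=> /linear_bounded_continuous/linear_boundedP/pinfty_ex_gt0[C C0 Cf] x.
have reN (V : hilbertType R) (v : V) : (complex.Re `|v|)%:C%C = `|v|.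
  by apply: RRe_real; exact: normr_real.
have ub : has_ubound [set complex.Re `|f x| | x in [set x : H | `|x| <= 1]].
  exists (complex.Re C) => _ [y /= y1 <-].
  rewrite -lecR reN RRe_real ?gtr0_real//.
  by rewrite (le_trans (Cf y))// ler_piMr// ltW.
have [->|x0] := eqVneq x 0; first by rewrite linear0 !normr0 mulr0.
have nx : 0 < `|x| by rewrite normr_gt0.
have : complex.Re `|f (`|x|^-1 *: x)| <= opnorm f.
  apply: ub_le_sup ub _ _; exists (`|x|^-1 *: x) => //=.
  by rewrite normrZ normfV normr_id mulVf ?gt_eqF.
rewrite -lecR reN linearZ normrZ normfV normr_id mulrC.
by rewrite ler_pdivrMr.
Qed.

(** * The Wold decomposition of a pure isometry *)

(* A vector orthogonal to all T^n L, L = (range T)^perp, is divisible by every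
   power of T: being orthogonal to L it is T g, and g is again such a vector. *)
Lemma orthogonal_wandering_divisible H (T : {linear H -> H}) :
  isometric T -> forall n u,
  (forall k l, orthocompl (range T) l -> hdot u (iter k T l) = 0) ->
  exists g, iter n T g = u.
Proof.
move=> isoT; elim=> [|n IH] u uL; first by exists u.
have [_ [g _ <-] gP] :=
  orthogonal_decomposition (isometric_range_closed_subspace isoT) u.
have w0 : u - T g = 0.
  apply/eqP; rewrite -normr_eq0 -sqrf_eq0 -hdot_norm linearBr /=.
  rewrite (gP (T g)); last by exists g.
  by rewrite subr0 hdotC; have /= -> := uL 0%N _ gP; rewrite conjC0.
have uE : u = T g by apply/eqP; rewrite -subr_eq0 w0.
have [|g' g'E] := IH g.
  by move=> k l Ll; rewrite -(isometric_hdot isoT) -uE -iterS uL.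
by exists g'; rewrite iterS g'E.
Qed.

Lemma pure_isometry_unilateral_shift H (T : {linear H -> H}) :
  isometric T ->
  (forall h, (forall n, exists g, iter n T g = h) -> h = 0) ->
  unilateral_shift T.
Proof.
move=> isoT pureT; split=> //; exists [set 0], setT; split=> //.
have orth0 : orthocompl [set 0 : H] = setT.
  by apply/seteqP; split=> // x _ _ ->; exact: linear0r.
split.
- split.
  + split=> //; last by move=> a _ _ -> ->; rewrite scaler0 addr0.
    apply: closed_approx => x near0; apply: ball_approx_eq0 => e /near0[_ ->].
    by rewrite subr0.
  + by move=> _ [_ -> <-]; exact: linear0.
  + by rewrite orth0.
- split=> [|x _]; last exact: isoT.
  by rewrite image_set1 linear0.
- by rewrite orth0.
- set S := (X in closed_span X); apply/esym/seteqP; split=> // x _.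
  (* The component of [x] orthogonal to all wandering spaces is divisible by every power of [T],
     hence zero by purity. *)
  have [m Sm mP] := orthogonal_decomposition (closed_span_closed_subspace S) x.
  suff xm0 : x - m = 0 by rewrite -(subrK m x) xm0 add0r.
  apply: pureT => n; apply: orthogonal_wandering_divisible => // k l Ll.
  by apply: mP => M [_]; apply; exists k => //; exists l.
Qed.

(** * Weak decay of the powers of the lifting *)

(* It is enough to test k = U^m (J x), where for n >= m the inner product is
   <U^(n-m) q, J x> = <T^(n-m) (P q), x> = 0. *)
Lemma lifting_decay H K (T : {linear H -> H}) (J : {linear H -> K})
    (P : {linear K -> H}) (U : {linear K -> K}) :
  minimal_isometric_lifting T J P U ->
  forall (k : K) e, 0 < e ->
  exists n, forall q, P q = 0 -> `|hdot (iter n U q) k| <= e * `|q|.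
Proof.
move=> [isoJ orthP isoU liftU span] k.
(* Asking for all [n] beyond a threshold, rather than a single [n], makes [D] stable under sums:
   take the larger threshold. *)
pose D := [set k : K | forall e, 0 < e -> exists N, forall n, (N <= n)%N ->
  forall q, P q = 0 -> `|hdot (iter n U q) k| <= e * `|q|].
suff Dk : D k.
  by move=> e e0; have [N NP] := Dk e e0; exists N; exact: NP.
have : setT k by [].
rewrite -span; apply; split; last first.
  move=> _ [m _ [_ [x _ <-] <-]] e e0; exists m => n mn q q0.
  rewrite -(subnKC mn) iterD isometric_iter_hdot//.
  have Pq : P (iter (n - m) U q) = 0.
    by elim: (n - m)%N => //= i IH; rewrite liftU IH linear0.
  have := orthP (iter (n - m) U q) x.
  by rewrite Pq linear0 subr0 => ->; rewrite normr0 mulr_ge0// ltW.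
split.
- apply: closed_approx => x near_x e e0.
  have e20 : 0 < e / 2 by rewrite divr_gt0.
  have [y Dy xy] := near_x _ e20.
  have [N NP] := Dy _ e20; exists N => n Nn q q0.
  rewrite -(subrK y x) linearDr /= (splitr e) mulrDl.
  apply: le_trans (ler_normD _ _) _; apply: lerD; last exact: NP.
  (* Since [U] is isometric, the error from replacing [x] by [y] is at most [|q| |x - y|], uniformly
     in [n]. *)
  apply: le_trans (cauchy_schwarz _ _) _.
  by rewrite isometric_iter// mulrC ler_wpM2r// ltW.
- by move=> e e0; exists 0%N => n _ q _; rewrite linear0r normr0 mulr_ge0// ltW.
- move=> a x y Dx Dy e e0.
  have a1 : 0 < `|a| + 1 by rewrite ltr_wpDl.
  pose d := e / (`|a| + 1).
  have d0 : 0 < d by rewrite divr_gt0.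
  have [N1 N1P] := Dx d d0; have [N2 N2P] := Dy d d0.
  exists (maxn N1 N2) => n; rewrite geq_max => /andP[N1n N2n] q q0.
  have -> : e = `|a| * d + d by rewrite -[X in _ + X]mul1r -mulrDl mulrC divfK// gt_eqF.
  rewrite linearDr /= mulrDl; apply: le_trans (ler_normD _ _) _.
  apply: lerD; last exact: N2P.
  by rewrite hdotZr normrM norm_conjC -mulrA ler_wpM2l// N1P.
Qed.

End HilbertSpaces.

Theorem proposition4p3 (R : realType) (H H' K' : hilbertType R)
    (sepH : separable H) (sepH' : separable H') (sepK' : separable K')
    (T' : {linear H' -> H'}) (T : {linear H -> H}) (X : {linear H -> H'})
    (contrT' : contraction_operator T') (cnuT' : completely_nonunitary T')
    (isoT : isometric T)
    (contX : continuous X) (intX : forall h : H, T' (X h) = X (T h))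
    (J : {linear H' -> K'}) (P' : {linear K' -> H'}) (U' : {linear K' -> K'})
    (lifting : minimal_isometric_lifting T' J P' U')
    (normX : opnorm X < 1)
    (isoY : exists Y1 : {linear H -> K'},
       [/\ isometric Y1,
           forall h : H, U' (Y1 h) = Y1 (T h)
         & forall h : H, P' (Y1 h) = X h]) :
  unilateral_shift T.
Proof.
have [Y [isoY1 intY liftY]] := isoY.
have [isoJ orthP isoU liftU _] := lifting.
apply: pure_isometry_unilateral_shift => // h divh.
apply/eqP; apply: contraT => h0.
have nh : 0 < `|h| by rewrite normr_gt0.
pose c : R[i] := (opnorm X)%:C%C.
have c1 : c < 1 by rewrite ltcR.
have c0 : 0 <= c.
  by have := le_trans (normr_ge0 _) (le_opnorm contX h); rewrite pmulr_lge0.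
pose d := 1 - c ^+ 2.
have d0 : 0 < d by rewrite subr_gt0 expr_lt1.
(* This tolerance will give [|q|^2 <= d |h|^2 / 2], against the lower bound [d |h|^2]. The exponent
   [n] is fixed before [g] and [q], which depend on it; uniformity of the decay in [q] permits
   this. *)
have e0 : 0 < d * `|h| / 2 by rewrite divr_gt0// mulr_gt0.
have [n decay] := lifting_decay lifting (Y h) e0.
have [g gh] := divh n.
have ng : `|g| = `|h| by rewrite -gh isometric_iter.
pose q := Y g - J (X g).
have Yg : Y g = q + J (X g) by rewrite subrK.
have qJ : hdot q (J (X g)) = 0 by rewrite /q -liftY orthP.
have Pq : P' q = 0.
  by rewrite linearB /= (orthogonal_projectionK isoJ orthP) liftY subrr.
(* Intertwining turns [Y h] into [U'^n (Y g)]; the isometry [U'^n] cancels, and only the component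
   [q] of [Y g] pairs with [q]. *)
have qY : `|q| ^+ 2 = hdot (iter n U' q) (Y h).
  have -> : Y h = iter n U' (Y g).
    by rewrite -gh; elim: n {decay gh} => //= n <-; rewrite intY.
  by rewrite isometric_iter_hdot// Yg linearDr /= qJ addr0 hdot_norm.
have pyth : `|h| ^+ 2 = `|q| ^+ 2 + `|X g| ^+ 2.
  by rewrite -ng -isoY1 Yg pythagoras// isoJ.
have qle : `|q| <= `|h|.
  by rewrite -ler_sqr ?nnegrE// pyth lerDl exprn_ge0.
have dq : d * `|h| ^+ 2 <= `|q| ^+ 2.
  rewrite /d mulrBl mul1r {1}pyth lerBlDr lerD2l -exprMn ler_sqr ?nnegrE ?mulr_ge0//.
  by rewrite -ng le_opnorm.
have qd : `|q| ^+ 2 <= d * `|h| ^+ 2 / 2.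
  rewrite -[_ ^+ 2]ger0_norm ?exprn_ge0// qY (le_trans (decay _ Pq))//.
  have -> : d * `|h| ^+ 2 / 2 = d * `|h| / 2 * `|h| by field.
  by rewrite ler_wpM2l// ltW.
have a0 : 0 < d * `|h| ^+ 2 by rewrite mulr_gt0 ?exprn_gt0.
have := le_trans dq qd.
by rewrite ler_pdivlMr// ger_pMr// lern1.
Qed.
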